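(* Let $\Sigma$ and $\tilde\Sigma$ be the asymptotic covariance matrices of the Conditional Permutation and the Conditional Randomisation schemes respectively, i.e. the matrices indexed by $\mathcal X\times\mathcal Y\times\mathcal Z$ with entries $$\Sigma_{x,y,z}^{x',y',z'}=\mathbb I(z=z')p(z)\Big(p(x|z)p(y|z)p(x'|z)p(y'|z)-\mathbb I(x=x')p(x|z)p(y|z)p(y'|z)-\mathbb I(y=y')p(x|z)p(x'|z)p(y|z)+\mathbb I(x=x',y=y')p(x|z)p(y|z)\Big),$$ $$\tilde\Sigma_{x,y,z}^{x',y',z'}=\mathbb I(y=y',z=z')\big(\mathbb I(x=x')p(x|z)p(y|z)p(z)-p(x|z)p(x'|z')p(y|z)p(z)\big).$$ Then $\tilde\Sigma\ge\Sigma$, i.e. the matrix $\tilde\Sigma-\Sigma$ is positive semi-definite.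
   Context: $p=(p(x,y,z))$ is a probability mass function on $\mathcal X\times\mathcal Y\times\mathcal Z$ (finite sets) with $p(x,y,z)>0$ for all $(x,y,z)$; $p(z)$ is its marginal in $z$, and $p(x|z)$, $p(y|z)$ are its conditional probabilities. $\mathbb I$ denotes the indicator. Subscripts $(x,y,z)$ index rows and superscripts $(x',y',z')$ index columns. *)

(* Defs.v *)
From mathcomp Require Export all_boot all_order all_algebra.
From mathcomp Require Export reals.

Set Implicit Arguments.
Unset Strict Implicit.
Unset Printing Implicit Defensive.

Import Order.TTheory GRing.Theory Num.Theory.
Local Open Scope ring_scope.

Definition psdmx (R : realType) (n : nat) (M : 'M[R]_n) : Prop :=
  M^T = M /\ forall v : 'cV[R]_n, 0 <= (v^T *m M *m v) 0 0.

(* A matrix indexed by a finite type I is encoded as a #|I| x #|I| matrix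
   through the canonical enumeration of I. *)
Definition fin_mx (R : realType) (I : finType) (F : I -> I -> R) :
  'M[R]_#|I| := \matrix_(i, j) F (enum_val i) (enum_val j).

Section Schemes.
Variables (R : realType) (X Y Z : finType) (p : X -> Y -> Z -> R).

Definition is_pmf : Prop :=
  (forall x y z, 0 <= p x y z) /\ \sum_x \sum_y \sum_z p x y z = 1.

Definition marg_z (z : Z) : R := \sum_x \sum_y p x y z.

(* p(x|z); the quotient is meaningful since p(z) > 0 for a positive pmf. *)
Definition cond_x (x : X) (z : Z) : R := (\sum_y p x y z) / marg_z z.

Definition cond_y (y : Y) (z : Z) : R := (\sum_x p x y z) / marg_z z.

(* The subscript (x, y, z) is the row index s and the superscript (x', y', z')
   is the column index t. *)
Definition cps_entry (s t : X * Y * Z) : R :=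
  let: (x, y, z) := s in
  let: (x', y', z') := t in
  (z == z')%:R * marg_z z *
  (cond_x x z * cond_y y z * cond_x x' z * cond_y y' z
   - (x == x')%:R * cond_x x z * cond_y y z * cond_y y' z
   - (y == y')%:R * cond_x x z * cond_x x' z * cond_y y z
   + ((x == x') && (y == y'))%:R * cond_x x z * cond_y y z).

Definition crs_entry (s t : X * Y * Z) : R :=
  let: (x, y, z) := s in
  let: (x', y', z') := t in
  ((y == y') && (z == z'))%:R *
  ((x == x')%:R * cond_x x z * cond_y y z * marg_z z
   - cond_x x z * cond_x x' z' * cond_y y z * marg_z z).

(* CPS: Conditional Permutation scheme; CRS: Conditional Randomisation scheme.
   The asymptotic covariance matrices are given by their closed-form entries. *)
Definition Sigma_CPS : 'M[R]_#|{: X * Y * Z}| := fin_mx cps_entry.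

Definition Sigma_CRS : 'M[R]_#|{: X * Y * Z}| := fin_mx crs_entry.

End Schemes.

(* Main.v *)
Require Import Defs.
From mathcomp Require Import ring.
Import Order.TTheory GRing.Theory Num.Theory.
Local Open Scope ring_scope.

(** Given z, let a be the law p(.|z) on X.  In the difference of the two
    covariances the terms carrying the indicator of y = y' cancel, and what is
    left is, up to the indicator of z = z',

      p(z) p(y|z) p(y'|z) (I(x = x') a(x) - a(x) a(x')),

    whose last factor is the covariance, under a, of the indicators of x and
    x' ([cov_indicators]).  A covariance is an average of products of centred
    variables, so the difference is a sum of rank-one matrices with
    nonnegative weights ([crs_sub_cps_gram]): the weights are p(z) a(x), and
    the vectors are the centred indicators, scaled by p(y|z) and supported on
    the slice z.  Such a sum is positive semi-definite ([psdmx_gram]). *)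

(** A weighted sum of squares: the quadratic form at v is the sum over k of
    c k times the square of the pairing of v with g k. *)
Lemma psdmx_gram (R : realType) (I K : finType) (F : I -> I -> R)
    (c : K -> R) (g : K -> I -> R) :
  (forall k, 0 <= c k) ->
  (forall s t, F s t = \sum_k c k * g k s * g k t) ->
  psdmx (fin_mx F).
Proof.
move=> c_ge0 FE; split=> [|v].
  apply/matrixP => i j; rewrite !mxE !FE.
  by apply: eq_bigr => k _; rewrite mulrAC.
pose h k := \sum_i v i 0 * g k (enum_val i).
suff -> : (v^T *m fin_mx F *m v) 0 0 = \sum_k c k * h k ^+ 2.
  by apply: sumr_ge0 => k _; rewrite mulr_ge0 ?sqr_ge0.
rewrite mxE.
under eq_bigr => j _.
  rewrite mxE mulr_suml.
  under eq_bigr => i _ do rewrite !mxE FE mulr_sumr mulr_suml.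
  rewrite exchange_big /=; over.
rewrite exchange_big /=; apply: eq_bigr => k _.
rewrite expr2 /h mulrCA mulr_suml exchange_big /=.
apply: eq_bigr => i _; rewrite mulr_sumr mulr_sumr.
by apply: eq_bigr => j _; ring.
Qed.

Lemma sum_indicator (R : realType) (X : finType) (f : X -> R) (x : X) :
  \sum_k f k * (x == k)%:R = f x.
Proof.
rewrite (bigD1 x) //= eqxx mulr1 big1 ?addr0 // => k kx.
by rewrite eq_sym (negPf kx) mulr0.
Qed.

(** The left side is the expectation of the product of the two centred
    indicators.  Expanding it, each of the two cross terms is - a x * a x', and
    the constant term is + a x * a x' because a has total mass 1. *)
Lemma cov_indicators (R : realType) (X : finType) (a : X -> R) (x x' : X) :
  \sum_k a k = 1 ->
  \sum_k a k * ((x == k)%:R - a x) * ((x' == k)%:R - a x') =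
    (x == x')%:R * a x - a x * a x'.
Proof.
move=> a1.
under eq_bigr => k _.
  have -> : a k * ((x == k)%:R - a x) * ((x' == k)%:R - a x') =
      a k * (x' == k)%:R * (x == k)%:R - a k * (x == k)%:R * a x'
      - a k * (x' == k)%:R * a x + a k * (a x * a x') by ring.
  over.
rewrite !big_split /= !sumrN -!mulr_suml.
rewrite !sum_indicator a1 eq_sym; ring.
Qed.

Section Conditionals.
Variables (R : realType) (X Y Z : finType) (p : X -> Y -> Z -> R).
Hypothesis p_ge0 : forall x y z, 0 <= p x y z.

Lemma marg_z_ge0 z : 0 <= marg_z p z.
Proof. by do 2![apply: sumr_ge0 => ? _]. Qed.

Lemma cond_x_ge0 x z : 0 <= cond_x p x z.
Proof. by rewrite divr_ge0 ?marg_z_ge0 ?sumr_ge0. Qed.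

Lemma sum_cond_x z : marg_z p z != 0 -> \sum_x cond_x p x z = 1.
Proof. by move=> nz; rewrite -mulr_suml divff. Qed.

(** Pairing a function v of (x, y, z) with this vector averages v over y
    under p(y|z) and takes the deviation at x = k.1 of that average from its
    mean over x; so the Gram form it yields is a conditional variance.  The
    index k contains z so that one sum covers all the slices. *)
Definition centred_vector (k : X * Z) (s : X * Y * Z) : R :=
  let: (x, y, z) := s in
  (z == k.2)%:R * cond_y p y z * ((x == k.1)%:R - cond_x p x z).

(** The sum over k collapses to the slice k.2 = z, on which it is the
    covariance of indicators computed in [cov_indicators]. *)
Lemma crs_sub_cps_gram s t :
  crs_entry p s t - cps_entry p s t =
  \sum_k marg_z p k.2 * cond_x p k.1 k.2
    * centred_vector k s * centred_vector k t.
Proof.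
case: s => [[x y] z]; case: t => [[x' y'] z'] /=.
rewrite -(pair_big xpredT xpredT (fun k1 k2 =>
  marg_z p k2 * cond_x p k1 k2
  * ((z == k2)%:R * cond_y p y z * ((x == k1)%:R - cond_x p x z))
  * ((z' == k2)%:R * cond_y p y' z' * ((x' == k1)%:R - cond_x p x' z')))) /=.
rewrite exchange_big (bigD1 z) //= [X in _ = _ + X]big1 ?addr0 => [|k kz]; last first.
  by apply: big1 => ? _; rewrite eq_sym (negPf kz) !(mul0r, mulr0).
rewrite eqxx (eq_sym z' z).
have [<-{z'}|zz'] := eqVneq z z'; last first.
  rewrite andbF !mul0r subr0 big1 // => ? _.
  by rewrite !(mul0r, mulr0).
(* When p(z) = 0 the quotient defining p(.|z) does not sum to 1, but both sides
   carry the factor p(z). *)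
have [m0|m0] := eqVneq (marg_z p z) 0.
  rewrite m0 big1 => [|? _]; last by rewrite !mul0r.
  by rewrite !(mulr0, mul0r) !subr0 mulr0.
transitivity (marg_z p z * cond_y p y z * cond_y p y' z *
    ((x == x')%:R * cond_x p x z - cond_x p x z * cond_x p x' z)).
  have [<-|_] := eqVneq y y'; case: (x == x') => /=; ring.
rewrite -(cov_indicators _ _ _ x x' (sum_cond_x _ m0)) mulr_sumr.
apply: eq_bigr => k _ /=; ring.
Qed.

End Conditionals.

Theorem lemma12 (R : realType) (X Y Z : finType) (p : X -> Y -> Z -> R)
    (p_pmf : is_pmf p) (p_gt0 : forall x y z, 0 < p x y z) :
  psdmx (Sigma_CRS p - Sigma_CPS p).
Proof.
have p_ge0 := p_pmf.1.
have -> : Sigma_CRS p - Sigma_CPS p =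
    fin_mx (fun s t => crs_entry p s t - cps_entry p s t).
  by apply/matrixP => i j; rewrite !mxE.
apply: psdmx_gram (crs_sub_cps_gram _ _ _ _ p) => k.
by rewrite mulr_ge0 ?marg_z_ge0 ?cond_x_ge0.
Qed.
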